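(* Let $R$ be a commutative semiring (not assumed to have a multiplicative identity). Suppose that there exist an integer $n\geq 1$ and a matrix $A\in M_n(R)$ such that the map $R^n\to R^n$, $x\mapsto Ax$, is surjective. Then $R$ has a multiplicative identity, i.e. there is $1\in R$ with $1\cdot r=r\cdot 1=r$ for all $r\in R$. Moreover, every such surjective matrix is invertible: for every $n\geq 1$ and every $A\in M_n(R)$ such that $x\mapsto Ax$ is surjective on $R^n$, there is $B\in M_n(R)$ with $AB=BA=I_n$, where $I_n$ is the identity matrix formed with the multiplicative identity of $R$.
   Context: A commutative semiring is a commutative monoid $(R,+,0)$ together with an associative and commutative multiplication that distributes over addition and for which $0$ is absorbing ($0\cdot r=0$ for all $r$). A multiplicative identity is not assumed, and neither is additive cancellation. $M_n(R)$ is the set of $n\times n$ matrices with entries in $R$, with the usual matrix multiplication; a matrix $A=(a_{ij})$ acts on column vectors $x\in R^n$ by $(Ax)_i=\sum_{j=1}^n a_{ij}x_j$. *)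

(* Defs.v *)
From HB Require Import structures.
From mathcomp Require Import all_boot all_algebra.

Set Implicit Arguments.
Unset Strict Implicit.
Unset Printing Implicit Defensive.

Import GRing.Theory.
Local Open Scope ring_scope.

(* MathComp's semirings all carry a unit.  Here neither a unit, nor 0 <> 1, nor
   additive cancellation is assumed.  Right distributivity and absorption
   follow from commutativity. *)
HB.mixin Record Nmodule_isComSemiRng R of GRing.Nmodule R := {
  rngmul : R -> R -> R;
  rngmulA : associative rngmul;
  rngmulC : commutative rngmul;
  rngmulDl : left_distributive rngmul +%R;
  rngmul0l : left_zero 0 rngmul
}.

#[short(type="comSemiRngType")]
HB.structure Definition ComSemiRng :=
  { R of Nmodule_isComSemiRng R & GRing.Nmodule R }.

Definition is_mul_identity (R : comSemiRngType) (e : R) : Prop :=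
  forall r : R, rngmul e r = r /\ rngmul r e = r.

(* [mulmx] requires a unital semiring.  With p = 1 this is also the action of a
   matrix on column vectors. *)
Definition rngmulmx (R : comSemiRngType) (m n p : nat)
    (A : 'M[R]_(m, n)) (B : 'M[R]_(n, p)) : 'M[R]_(m, p) :=
  \matrix_(i < m, k < p) \sum_(j < n) rngmul (A i j) (B j k).

Definition rng_scalar_mx (R : comSemiRngType) (n : nat) (e : R) : 'M[R]_n :=
  \matrix_(i < n, j < n) (if i == j then e else 0).

Definition mx_surjective (R : comSemiRngType) (n : nat) (A : 'M[R]_n) : Prop :=
  forall y : 'cV[R]_n, exists x : 'cV[R]_n, rngmulmx A x = y.

(* Main.v *)
(* The determinant is split into its even and odd parts, so that no subtraction
   is needed.  If A B = diag(d_1, ..., d_n), then every A i k * B k j with i <> j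
   has an additive inverse, and expanding det(A B) and applying Cramer's rule
   shows that A u determines d_1 ... d_n u.  If A is surjective then d is
   arbitrary and R = R R, so A u = A v gives r u = r v for all r in R.  Applied
   to a solution X of A X = A, this makes X 0 0 an identity on R R = R; applied
   to A (B A) = A I, it turns a right inverse B into a left inverse.  Products
   over R, which has no unit a priori, are computed in its unital extension
   N x R. *)
Require Import Defs.
From HB Require Import structures.
From mathcomp Require Import all_boot all_algebra all_fingroup.

Set Implicit Arguments.
Unset Strict Implicit.
Unset Printing Implicit Defensive.

Import GRing.Theory.
Local Open Scope ring_scope.

(** * Even and odd parts of determinants over a commutative semiring *)

Section SignedDeterminant.
Variable T : comPzSemiRingType.

Definition sdet (b : bool) n (A : 'M[T]_n) : T :=
  \sum_(s : 'S_n | odd_perm s == b) \prod_i A i (s i).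

(* The terms of [sdet b (A *m B)] that come from injective index maps. *)
Definition sdet_prod (b : bool) n (A B : 'M[T]_n) : T :=
  \sum_(c : bool) sdet c A * sdet (c (+) b) B.

(** The matrix whose determinant is the numerator in Cramer's rule. *)
Definition replace_col n (A : 'M[T]_n) (k : 'I_n) (w : 'cV[T]_n) : 'M[T]_n :=
  \matrix_(i, j) if j == k then w i 0 else A i j.

Lemma sdet_tr b n (A : 'M[T]_n) : sdet b A^T = sdet b A.
Proof.
rewrite [LHS](reindex_inj invg_inj) /=.
apply: eq_big => [s | s _]; first by rewrite odd_permV.
by rewrite (reindex_perm s); apply: eq_bigr => i _; rewrite mxE permK.
Qed.

(** Composing with the transposition of the two equal rows reverses parity and preserves each
    product of entries. *)
Lemma sdet_eq_rows b n (A : 'M[T]_n) i1 i2 :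
  i1 != i2 -> A i1 =1 A i2 -> sdet b A = sdet (~~ b) A.
Proof.
move=> neq_i12 eqA12; pose t := tperm i1 i2.
rewrite [LHS](reindex_inj (mulgI t)) /=; apply: eq_big => [s | s _].
  by rewrite odd_permM odd_tperm neq_i12; case: odd_perm; case: b.
rewrite (reindex_perm t); apply: eq_bigr => /= i _.
by rewrite permM tpermK /t; case: tpermP => // ->; rewrite eqA12.
Qed.

Lemma sdet_eq_cols b n (A : 'M[T]_n) j1 j2 :
  j1 != j2 -> (forall i, A i j1 = A i j2) -> sdet b A = sdet (~~ b) A.
Proof.
move=> neq_j12 eqA; rewrite -sdet_tr -[RHS]sdet_tr.
by apply: sdet_eq_rows neq_j12 _ => i; rewrite !mxE.
Qed.

Lemma sdet_row_perm b n (s : 'S_n) (A : 'M[T]_n) :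
  sdet b (row_perm s A) = sdet (odd_perm s (+) b) A.
Proof.
rewrite [RHS](reindex_inj (mulgI s^-1%g)) /=; apply: eq_big => [t | t _].
  by rewrite odd_permM odd_permV; case: odd_perm; case: odd_perm; case: b.
rewrite [RHS](reindex_perm s); apply: eq_bigr => i _.
by rewrite mxE permM permK.
Qed.

(** Expand each product of row sums over index maps [f]. A non-injective [f] repeats a row of [B],
    so its contribution is the same for both parities; these terms form [r]. *)
Lemma sdet_mul n (A B : 'M[T]_n) :
  exists r, forall b, sdet b (A *m B) = sdet_prod b A B + r.
Proof.
pose Bf (f : {ffun 'I_n -> 'I_n}) : 'M[T]_n := \matrix_(i, j) B (f i) j.
exists (\sum_(f : {ffun 'I_n -> 'I_n} | ~~ injectiveb f)
          (\prod_i A i (f i)) * sdet false (Bf f)) => b.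
have -> : sdet b (A *m B) =
    \sum_(f : {ffun 'I_n -> 'I_n}) (\prod_i A i (f i)) * sdet b (Bf f).
  transitivity (\sum_(s : 'S_n | odd_perm s == b)
      \sum_(f : {ffun 'I_n -> 'I_n}) \prod_i (A i (f i) * B (f i) (s i))).
    apply: eq_bigr => s _.
    rewrite -(bigA_distr_bigA (fun i j => A i j * B j (s i))) /=.
    by apply: eq_bigr => i _; rewrite mxE.
  rewrite exchange_big; apply: eq_bigr => f _; rewrite big_distrr /=.
  by apply: eq_bigr => s _; rewrite big_split; congr (_ * _);
     apply: eq_bigr => i _; rewrite mxE.
rewrite (bigID (fun f : {ffun 'I_n -> 'I_n} => injectiveb f)) /=; congr (_ + _).
  rewrite (reindex (@pval _)) /=; last first.
    (* The default permutation is never reached, since only injective maps are converted. *)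
    pose in_Sn := insubd (1%g : 'S_n).
    by exists in_Sn => /= f Uf; first apply: val_inj; apply: insubdK.
  rewrite /sdet_prod (partition_big (@odd_perm _) predT) //=.
  apply: eq_bigr => c _; rewrite big_distrl /=.
  apply: eq_big => [s | s /andP[_ /eqP <-]]; first by rewrite (valP s).
  rewrite -sdet_row_perm; congr (_ * _).
    by apply: eq_bigr => i _; rewrite pvalE.
  by congr (sdet b _); apply/matrixP => i j; rewrite !mxE pvalE.
apply: eq_bigr => f /injectivePn[i1 [i2 neq_i12 eqf]]; congr (_ * _).
case: b => //; apply: (sdet_eq_rows _ neq_i12) => j.
by rewrite !mxE eqf.
Qed.

Lemma sdet_diag b n (d : 'rV[T]_n) :
  sdet b (diag_mx d) = if b then 0 else \prod_i d 0 i.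
Proof.
have zero (s : 'S_n) : s != 1%g -> \prod_i diag_mx d i (s i) = 0.
  move=> s1; have [i neq_i] : exists i, s i != i.
    apply/existsP; apply: contraNT s1; rewrite negb_exists => /forallP s1.
    by apply/eqP/permP => i; rewrite perm1; apply/eqP; rewrite -[_ == _]negbK.
  by rewrite (bigD1 i) //= mxE eq_sym (negPf neq_i) mul0r.
case: b; first by rewrite /sdet big1 // => s os; apply: zero;
  apply: contraTneq os => ->; rewrite odd_perm1.
rewrite /sdet (bigD1 1%g) ?odd_perm1 //= [X in _ + X]big1 ?addr0.
  by apply: eq_bigr => i _; rewrite perm1 mxE eqxx.
by move=> s /andP[_ /zero].
Qed.

Lemma replace_col_col n (A : 'M[T]_n) k : replace_col A k (col k A) = A.
Proof. by apply/matrixP => i j; rewrite !mxE; case: eqP => // ->. Qed.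

Lemma sdet_replace_col_mul b n (A : 'M[T]_n) k (u : 'cV[T]_n) :
  sdet b (replace_col A k (A *m u)) =
  \sum_l u l 0 * sdet b (replace_col A k (col l A)).
Proof.
have prodE (w : 'cV[T]_n) (s : 'S_n) :
    \prod_i replace_col A k w i (s i) =
    w (s^-1%g k) 0 * \prod_(i | i != s^-1%g k) A i (s i).
  rewrite (bigD1 (s^-1%g k)) //= mxE permKV eqxx; congr (_ * _).
  apply: eq_bigr => i neq_i; rewrite mxE; case: eqP => // sik.
  by rewrite -sik permK eqxx in neq_i.
transitivity (\sum_(s : 'S_n | odd_perm s == b) \sum_l
    u l 0 * \prod_i replace_col A k (col l A) i (s i)).
  apply: eq_bigr => s _; rewrite prodE mxE big_distrl /=.
  by apply: eq_bigr => l _; rewrite prodE mxE mulrA [u l 0 * _]mulrC.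
by rewrite exchange_big; apply: eq_bigr => l _; rewrite big_distrr.
Qed.

(** * Additively invertible elements and Cramer's rule *)

Definition addinv (x : T) : Prop := exists y : T, x + y = 0.

Lemma addinvDl x y : addinv (x + y) -> addinv x.
Proof. by case=> z; rewrite -addrA; exists (y + z). Qed.

Lemma addinvD x y : addinv x -> addinv y -> addinv (x + y).
Proof.
by case=> x' xx' [y' yy']; exists (x' + y'); rewrite addrACA xx' yy' addr0.
Qed.

Lemma addinvMl a x : addinv x -> addinv (a * x).
Proof. by case=> y xy; exists (a * y); rewrite -mulrDr xy mulr0. Qed.

Lemma addinv_sum (I : Type) (r : seq I) (P : pred I) (F : I -> T) :
  (forall i, P i -> addinv (F i)) -> addinv (\sum_(i <- r | P i) F i).
Proof.
move=> PF; elim/big_rec: _ => [|i x /PF]; first by exists 0; rewrite addr0.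
exact: addinvD.
Qed.

Lemma addinv_uniq (x y z : T) : x + y = 0 -> x + z = 0 -> y = z.
Proof.
by move=> xy xz; rewrite -[y]addr0 -xz addrA [y + x]addrC xy add0r.
Qed.

(** The sum forming an off-diagonal entry vanishes, so the other terms add up to the inverse of the
    given one. *)
Lemma addinv_offdiag n (A B : 'M[T]_n) d i j k :
  A *m B = diag_mx d -> i != j -> addinv (A i k * B k j).
Proof.
move=> AB neq_ij; have /matrixP /(_ i j) := AB.
rewrite !mxE (negPf neq_ij) (bigD1 k) //= => AB0.
by apply: (@addinvDl _ (\sum_(l | l != k) A i l * B l j)); exists 0;
  rewrite AB0 addr0.
Qed.

(* Both copies of column l contribute an entry of A that meets the same entry of
   B, and at least one of the two products is off-diagonal in A *m B. *)
Lemma addinv_sdet_eq_cols b c n (A B : 'M[T]_n) d k l :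
  A *m B = diag_mx d -> l != k ->
  addinv (sdet b (replace_col A k (col l A)) * sdet c B).
Proof.
move=> AB neq_lk; rewrite big_distrlr /=.
apply: addinv_sum => s _; apply: addinv_sum => t _.
set i := s^-1%g k; set j := s^-1%g l.
have neq_ji : j != i by rewrite (inj_eq perm_inj).
rewrite [X in _ * X](bigD1 l) //= mulrA mulrC; apply: addinvMl.
rewrite (bigD1 i) //= (bigD1 j) //= !mxE !permKV eqxx (negPf neq_lk).
(* Since [i] and [j] differ, at most one of them is [t l]; the other row supplies the off-diagonal
   product. *)
have [eq_ti|neq_ti] := eqVneq i (t l).
  by rewrite mulrCA mulrAC mulrC; apply: addinvMl; apply: (addinv_offdiag _ AB);
     rewrite -eq_ti.
by rewrite mulrAC mulrC; apply: addinvMl; apply: (addinv_offdiag _ AB).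
Qed.

(* Cramer's rule with the subtraction replaced by the addition of y. *)
Lemma sdet_cramer n (A B : 'M[T]_n) d (u : 'cV[T]_n) k :
  A *m B = diag_mx d ->
  exists2 y, sdet_prod true (replace_col A k (A *m u)) B + y = 0 &
    sdet_prod false (replace_col A k (A *m u)) B + y = (\prod_i d 0 i) * u k 0.
Proof.
move=> AB; have [r sdetAB] := sdet_mul A B.
have := sdetAB true; have := sdetAB false; rewrite AB !sdet_diag => pE mE.
pose S b l c := sdet b (replace_col A k (col l A)) * sdet c B.
(* The terms of the linear expansion in column [k] that repeat a column; their total does not depend
   on the parity [b]. *)
pose t := \sum_(l | l != k) u l 0 * (S false l true + S false l false).
have [t' tt'] : addinv t.
  apply: addinv_sum => l neq_lk; apply: addinvMl.
  by apply: addinvD; apply: (addinv_sdet_eq_cols _ _ AB neq_lk).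
have QE b : sdet_prod b (replace_col A k (A *m u)) B =
    u k 0 * sdet_prod b A B + t.
  transitivity (\sum_l u l 0 * sdet_prod b (replace_col A k (col l A)) B).
    rewrite /sdet_prod; under eq_bigr do rewrite sdet_replace_col_mul big_distrl.
    rewrite exchange_big; apply: eq_bigr => l _; rewrite big_distrr /=.
    by apply: eq_bigr => c _; rewrite mulrA.
  rewrite (bigD1 k) //= replace_col_col; congr (_ + _).
  apply: eq_bigr => l neq_lk; congr (_ * _).
  have Strue c : S true l c = S false l c.
    congr (_ * _); apply: (sdet_eq_cols _ neq_lk) => i.
    by rewrite !mxE eqxx (negPf neq_lk).
  rewrite /sdet_prod big_bool /= -/(S true l _) -/(S false l _) Strue.
  by case: b => //=; rewrite addrC.
(* Here [t'] cancels [t], and [r] completes [sdet_prod] to the signed parts of the diagonal matrix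
   [A *m B]. *)
by exists (u k 0 * r + t'); rewrite QE addrACA tt' addr0 -mulrDr -?mE -?pE;
  rewrite ?mulr0 // mulrC.
Qed.

(** In Cramer's rule [y] is the additive inverse of a quantity depending on [u] only through
    [A *m u]; inverses being unique, so does [y]. *)
Lemma mulmx_diag_cancel n (A B : 'M[T]_n) d (u v : 'cV[T]_n) k :
  A *m B = diag_mx d -> A *m u = A *m v ->
  (\prod_i d 0 i) * u k 0 = (\prod_i d 0 i) * v k 0.
Proof.
move=> AB Auv; have [y + <-] := sdet_cramer u k AB.
have [z + <-] := sdet_cramer v k AB; rewrite Auv => z0 y0.
by rewrite (addinv_uniq y0 z0).
Qed.

End SignedDeterminant.

Lemma rngmulDr (R : comSemiRngType) : right_distributive (@rngmul R) +%R.
Proof. by move=> x y z; rewrite rngmulC rngmulDl ![rngmul _ x]rngmulC. Qed.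

Lemma rngmul0r (R : comSemiRngType) : right_zero 0 (@rngmul R).
Proof. by move=> x; rewrite rngmulC rngmul0l. Qed.

Lemma rngmul_sumr (R : comSemiRngType) (I : Type) (s : seq I) (F : I -> R) r :
  rngmul r (\sum_(i <- s) F i) = \sum_(i <- s) rngmul r (F i).
Proof. exact: (big_morph (rngmul r) (rngmulDr r) (rngmul0r r)). Qed.

(** * The Dorroh extension, adjoining a unit *)

Section Dorroh.
Variable R : comSemiRngType.

(** The pair [(n, r)] stands for [n * 1 + r]; natural numbers suffice because no negatives are
    required. *)
Definition dorroh : Type := (nat * R)%type.

HB.instance Definition _ := GRing.Nmodule.copy dorroh (nat * R)%type.

Definition dorroh_one : dorroh := (1%N, 0).

Definition dorroh_mul (x y : dorroh) : dorroh :=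
  (x.1 * y.1, y.2 *+ x.1 + x.2 *+ y.1 + rngmul x.2 y.2).

Let rngmulrnl (x y : R) n : rngmul (x *+ n) y = rngmul x y *+ n.
Proof.
by elim: n => [|n IHn]; rewrite ?mulr0n ?rngmul0l // !mulrS rngmulDl IHn.
Qed.

Let rngmulrnr (x y : R) n : rngmul x (y *+ n) = rngmul x y *+ n.
Proof. by rewrite rngmulC rngmulrnl rngmulC. Qed.

Lemma dorroh_mulA : associative dorroh_mul.
Proof.
move=> x y z; congr pair; rewrite /= ?mulrA //.
rewrite !mulrnDl !rngmulDr !rngmulDl !rngmulrnl !rngmulrnr -!mulrnA rngmulA.
rewrite [(y.1 * x.1)%N]mulnC [(z.1 * x.1)%N]mulnC -!addrA.
congr (_ + (_ + _)); rewrite [LHS]addrCA; congr (_ + _).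
by rewrite [RHS]addrCA; congr (_ + _); rewrite addrCA.
Qed.

Lemma dorroh_mulC : commutative dorroh_mul.
Proof.
move=> x y; congr pair; rewrite /= 1?mulrC // [rngmul x.2 _]rngmulC.
by rewrite [_ *+ x.1 + _]addrC.
Qed.

Lemma dorroh_mul1r : left_id dorroh_one dorroh_mul.
Proof. by case=> n x; rewrite /dorroh_mul /= mul1r mul0rn rngmul0l !addr0. Qed.

Lemma dorroh_mulDl : left_distributive dorroh_mul +%R.
Proof.
move=> x y z; congr pair; rewrite /= ?mulrDl // mulrnDl mulrnDr rngmulDl.
by rewrite [RHS]addrACA; congr (_ + _); rewrite addrACA.
Qed.

Lemma dorroh_mul0r : left_zero 0 dorroh_mul.
Proof.
by case=> n x; rewrite /dorroh_mul /= mul0r mulr0n mul0rn rngmul0l !addr0.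
Qed.

HB.instance Definition _ := GRing.Nmodule_isComPzSemiRing.Build dorroh
  dorroh_mulA dorroh_mulC dorroh_mul1r dorroh_mulDl dorroh_mul0r.

Definition to_dorroh (r : R) : dorroh := (0%N, r).

Lemma to_dorroh_inj : injective to_dorroh.
Proof. by move=> x y []. Qed.

Lemma to_dorrohM x y : to_dorroh (rngmul x y) = to_dorroh x * to_dorroh y.
Proof. by congr pair; rewrite /= !mulr0n !add0r. Qed.

Lemma to_dorroh_sum (I : Type) (s : seq I) (F : I -> R) :
  to_dorroh (\sum_(i <- s) F i) = \sum_(i <- s) to_dorroh (F i).
Proof.
by apply: (big_morph to_dorroh) => // x y; congr pair; rewrite /= addr0.
Qed.

Lemma map_to_dorroh_mulmx m n p (A : 'M[R]_(m, n)) (B : 'M[R]_(n, p)) :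
  map_mx to_dorroh (rngmulmx A B) =
  map_mx to_dorroh A *m map_mx to_dorroh B.
Proof.
apply/matrixP => i j; rewrite !mxE to_dorroh_sum.
by apply: eq_bigr => k _; rewrite to_dorrohM !mxE.
Qed.

End Dorroh.

(** * Surjective matrices: cancellation and the identity element *)

Section Surjective.
Variable R : comSemiRngType.

Lemma rngmulmxA m n p q (A : 'M[R]_(m, n)) (B : 'M_(n, p)) (C : 'M_(p, q)) :
  rngmulmx A (rngmulmx B C) = rngmulmx (rngmulmx A B) C.
Proof.
have /matrixP AE : map_mx (@to_dorroh R) (rngmulmx A (rngmulmx B C)) =
    map_mx (@to_dorroh R) (rngmulmx (rngmulmx A B) C).
  by rewrite !map_to_dorroh_mulmx mulmxA.
apply/matrixP => i j; apply: to_dorroh_inj.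
by have := AE i j; rewrite ![map_mx _ _ _ _]mxE.
Qed.

Lemma mx_surjective_mulmx n p (A : 'M[R]_n) (C : 'M_(n, p)) :
  mx_surjective A -> exists X : 'M_(n, p), rngmulmx A X = C.
Proof.
move=> surjA; have [x xP] := fin_all_exists (fun j => surjA (col j C)).
exists (\matrix_(i, j) x j i 0); apply/matrixP => i j.
have /colP/(_ i) := xP j; rewrite !mxE => <-.
by apply: eq_bigr => k _; rewrite mxE.
Qed.

Lemma mx_surjective_sum n (A : 'M[R]_n.+1) (r : R) :
  mx_surjective A -> exists x, r = \sum_j rngmul (A 0 j) (x j).
Proof.
move=> surjA; have [x /colP/(_ 0)] := surjA (const_mx r).
by rewrite !mxE => <-; exists (fun j => x j 0).
Qed.

(** Induction on the number of factors: one factor is absorbed into [x] and [y], and two remaining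
    factors merge into one because every [r] is a sum of products. *)
Lemma mx_surjective_prod_cancel n (A : 'M[R]_n.+1) k (x y : R) :
  mx_surjective A ->
  (forall d : 'I_k.+1 -> R, (\prod_i to_dorroh (d i)) * to_dorroh x =
                            (\prod_i to_dorroh (d i)) * to_dorroh y) ->
  forall r, rngmul r x = rngmul r y.
Proof.
move=> surjA; elim: k x y => [|k IHk] x y xy r.
  have := xy (fun=> r); rewrite !big_ord_recl !big_ord0 !mulr1 -!to_dorrohM.
  exact: to_dorroh_inj.
have {}IHk s t : rngmul t (rngmul s x) = rngmul t (rngmul s y).
  (* The family passed to [xy] is [d] with [s] prepended. *)
  apply: IHk => d; have {xy} := xy (fun i => oapp d s (unlift ord0 i)).
  rewrite big_ord_recl unlift_none /=; under eq_bigr do rewrite liftK /=.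
  by rewrite !to_dorrohM !mulrA ![_ * to_dorroh s]mulrC.
have [z ->] := mx_surjective_sum r surjA.
rewrite ![rngmul (\sum_j _) _]rngmulC !rngmul_sumr; apply: eq_bigr => j _.
by rewrite ![rngmul _ (rngmul (A 0 j) _)]rngmulC -!rngmulA IHk.
Qed.

Lemma mx_surjective_cancel n p (A : 'M[R]_n.+1) (U W : 'M[R]_(n.+1, p)) :
  mx_surjective A -> rngmulmx A U = rngmulmx A W ->
  forall r i j, rngmul r (U i j) = rngmul r (W i j).
Proof.
move=> surjA AUW r i j; apply: (mx_surjective_prod_cancel (k := n) surjA) => d.
pose D : 'rV_n.+1 := \row_k to_dorroh (d k).
(* Surjectivity provides such a [B] for any prescribed diagonal [d]. *)
have [B AB] := mx_surjective_mulmx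
  (\matrix_(k, l) if k == l then d k else 0) surjA.
have ABD : map_mx (@to_dorroh R) A *m map_mx (@to_dorroh R) B = diag_mx D.
  rewrite -map_to_dorroh_mulmx AB; apply/matrixP => k l; rewrite !mxE.
  by case: eqP => [->|].
have /(mulmx_diag_cancel i ABD) :
    map_mx (@to_dorroh R) A *m col j (map_mx (@to_dorroh R) U) =
    map_mx (@to_dorroh R) A *m col j (map_mx (@to_dorroh R) W).
  by rewrite !colE !mulmxA -!map_to_dorroh_mulmx AUW.
by rewrite !mxE; under eq_bigr do rewrite mxE.
Qed.

Lemma mx_surjective_identity n (A : 'M[R]_n.+1) :
  mx_surjective A -> exists e : R, is_mul_identity e.
Proof.
move=> surjA; have [X AX] := mx_surjective_mulmx A surjA.
have XP r s : rngmul r (rngmul (X 0 0) s) = rngmul r s.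
  (* With [s] in position 0 only, entry 0 of [X W] is [X 0 0] times [s]. *)
  pose W : 'cV[R]_n.+1 := \col_i if i == 0 then s else 0.
  have := mx_surjective_cancel (U := rngmulmx X W) (W := W) surjA _ r 0 0.
  rewrite rngmulmxA AX !mxE => /(_ erefl); rewrite eqxx big_ord_recl mxE eqxx.
  by rewrite big1 ?addr0 // => i _; rewrite mxE rngmul0r.
exists (X 0 0) => r; rewrite [rngmul r _]rngmulC; split=> //;
  have [x ->] := mx_surjective_sum r surjA;
  by rewrite rngmul_sumr; apply: eq_bigr => j _;
     rewrite rngmulA [rngmul _ (A 0 j)]rngmulC -rngmulA XP.
Qed.

Lemma rngmulmx_scalar m n (A : 'M[R]_(m, n)) e :
  is_mul_identity e -> rngmulmx A (rng_scalar_mx n e) = A.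
Proof.
move=> eP; apply/matrixP => i j; rewrite mxE (bigD1 j) //= mxE eqxx.
rewrite (eP _).2 big1 ?addr0 // => k neq_kj.
by rewrite mxE (negPf neq_kj) rngmul0r.
Qed.

Lemma rng_scalar_mulmx m n (A : 'M[R]_(m, n)) e :
  is_mul_identity e -> rngmulmx (rng_scalar_mx m e) A = A.
Proof.
move=> eP; apply/matrixP => i j; rewrite mxE (bigD1 i) //= mxE eqxx.
rewrite (eP _).1 big1 ?addr0 // => k neq_ki.
by rewrite mxE eq_sym (negPf neq_ki) rngmul0l.
Qed.

End Surjective.

Theorem corollary10 (R : comSemiRngType)
    (hsurj : exists n : nat, (1 <= n)%N /\ exists A : 'M[R]_n, mx_surjective A) :
  exists e : R,
    is_mul_identity e /\
    forall (n : nat) (A : 'M[R]_n), (1 <= n)%N -> mx_surjective A ->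
      exists B : 'M[R]_n,
        rngmulmx A B = rng_scalar_mx n e /\ rngmulmx B A = rng_scalar_mx n e.
Proof.
case: hsurj => -[|m] [// _ [A0 surjA0]].
have [e eP] := mx_surjective_identity surjA0.
exists e; split=> // -[//|n] A _ surjA.
have [B AB] := mx_surjective_mulmx (rng_scalar_mx n.+1 e) surjA.
exists B; split=> //; apply/matrixP => i j.
(* Cancellation leaves a factor [r]; taking it to be the identity [e] gives equality of entries. *)
rewrite -[LHS](eP _).1 -[RHS](eP _).1; apply: (mx_surjective_cancel surjA).
by rewrite rngmulmxA AB rngmulmx_scalar // rng_scalar_mulmx.
Qed.
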